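(* Let $p\in\mathbb N$ and $\alpha_1,\dots,\alpha_p>-1$ with $\alpha_i-\alpha_j\notin\mathbb Z$ for $i\ne j$. Let $L_{\vec n}$ and $L^{(i)}_{\vec n}$ ($i=1,\dots,p$) be the multiple Laguerre polynomials of the first kind of type II (monic) and type I given in the context. Let $k\in\{1,\dots,p\}$, let $\pi$ be any permutation of $\{1,\dots,p\}$, and let $\vec s_j$, $S(\pi,j)$ be as in the context. Then the nearest-neighbor recurrence relations $$xL_{\vec n}(x)=L_{\vec n+\vec e_k}(x)+b^0_{\vec n}(k)L_{\vec n}(x)+\sum_{j=1}^p b^j_{\vec n}L_{\vec n-\vec s_j}(x),$$ $$xL^{(i)}_{\vec n}(x)=L^{(i)}_{\vec n-\vec e_k}(x)+b^0_{\vec n-\vec e_k}(k)L^{(i)}_{\vec n}(x)+\sum_{j=1}^p b^j_{\vec n+\vec s_{j-1}}L^{(i)}_{\vec n+\vec s_j}(x),\qquad i\in\{1,\dots,p\},$$ hold for all $\vec n\in\mathbb N_0^p$ such that all multi-indices occurring in the respective relation have non-negative entries, where $$b^0_{\vec n}(k)=(\alpha_k+n_k+1)\prod_{q=1}^p\frac{\alpha_k-\alpha_q+n_k+1}{\alpha_k-\alpha_q+n_k+1-n_q}+\sum_{i=1}^p\frac{\alpha_i+n_i}{\alpha_i-\alpha_k-n_k+n_i-1}\,\frac{\prod_{q=1}^p(\alpha_i-\alpha_q+n_i)}{\prod_{q=1,q\ne i}^p(\alpha_i-\alpha_q+n_i-n_q)},$$ $$b^j_{\vec n}=\sum_{i\in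 S(\pi,j)}\frac{(\alpha_i+n_i)\prod_{q=1}^p(\alpha_i-\alpha_q+n_i)}{\prod_{q\in S(\pi,j),\,q\ne i}(\alpha_i-\alpha_q+n_i-n_q)},\qquad j\in\{1,\dots,p\}.$$
   Context: $\mathbb N_0=\{0,1,2,\dots\}$; $|\vec n|=n_1+\cdots+n_p$; $(x)_0=1$, $(x)_n=x(x+1)\cdots(x+n-1)$; empty products equal $1$ and empty sums equal $0$; $\vec e_k$ is the $k$-th canonical basis vector of $\mathbb R^p$. For a permutation $\pi$ of $\{1,\dots,p\}$: $\vec s_0=\vec 0$, $\vec s_j=\sum_{i=1}^j\vec e_{\pi(i)}$, $S(\pi,j)=\{i\in\{1,\dots,p\}: j\le\pi^{-1}(i)\}$. The multiple Laguerre polynomials of the first kind are the multiple orthogonal polynomials for the weights $e^{-x}x^{\alpha_i}$, $i=1,\dots,p$, with respect to $dx$ on $[0,\infty)$. Type II (monic, degree $|\vec n|$): with $\lambda_r=l_r+\cdots+l_p$ ($1\le r\le p$), $\lambda_{p+1}=0$, $$L_{\vec n}(x)=\sum_{l_1=0}^{n_1}\cdots\sum_{l_p=0}^{n_p}(-1)^{|\vec n|}\prod_{q=1}^p\left[(\alpha_q+1)_{n_q}\frac{(-n_q)_{l_q}}{l_q!}\right]\prod_{r=1}^p\frac{(\alpha_r+n_r+1)_{\lambda_{r+1}}}{(\alpha_r+1)_{\lambda_r}}\;x^{l_1+\cdots+l_p}.$$ Type I: $L^{(i)}_{\vec n}=0$ if $n_i=0$, and if $n_i\ge1$, $$L^{(i)}_{\vec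 n}(x)=\frac{(-1)^{|\vec n|-1}}{(n_i-1)!\,\Gamma(\alpha_i+1)\prod_{q\ne i}(\alpha_q-\alpha_i)_{n_q}}\sum_{l=0}^{n_i-1}\frac{(-n_i+1)_l}{l!\,(\alpha_i+1)_l}\prod_{q\ne i}\frac{(\alpha_i-\alpha_q-n_q+1)_l}{(\alpha_i-\alpha_q+1)_l}\,x^l .$$ *)

(* Defs.v *)
From HB Require Import structures.
From mathcomp Require Import all_boot all_order all_algebra all_fingroup.
From mathcomp Require Import all_classical all_reals all_analysis.

Set Implicit Arguments.
Unset Strict Implicit.
Unset Printing Implicit Defensive.

Import Order.TTheory GRing.Theory Num.Theory.

Local Open Scope ring_scope.

(* Multi-indices in N_0^p. The entries, the numbers alpha_i and the values of
   a permutation are indexed by 'I_p = {0, ..., p-1}, i.e. shifted by one with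
   respect to {1, ..., p}. *)
Definition mindex (p : nat) := {ffun 'I_p -> nat}.

Section MultiIndex.
Variable p : nat.
Implicit Types m n : mindex p.

Definition mweight n : nat := (\sum_(i < p) n i)%N.

Definition mle m n : Prop := forall i, (m i <= n i)%N.

(* The subtraction of nat is truncated: msub n m is the difference of the
   vectors n and m only if mle m n. *)
Definition msub n m : mindex p := [ffun i => (n i - m i)%N].

Definition evec (k : 'I_p) : mindex p := [ffun i => (i == k : nat)].

(* e_{pi(1)} + ... + e_{pi(j)}, for 0 <= j <= p; the 0-based index i stands
   for i + 1, hence the strict inequality. *)
Definition svec (pi : 'S_p) (j : nat) : mindex p :=
  \sum_(i < p | (i < j)%N) evec (pi i).

(* S(pi, j) for 1 <= j <= p; the successor turns the 0-based value of the
   inverse permutation into a 1-based one, to be compared with j. *)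
Definition Sset (pi : 'S_p) (j : nat) : {set 'I_p} :=
  [set i | (j <= ((pi^-1)%g i).+1)%N].

End MultiIndex.

Section MultipleLaguerre.
Variable R : realType.

Definition poch (x : R) (n : nat) : R := \prod_(i < n) (x + i%:R).

Definition Gamma (z : R) : R :=
  \int[lebesgue_measure]_(x in `]0, +oo[%classic) (x `^ (z - 1) * expR (- x)).

Variable p : nat.
Implicit Types (alpha : 'I_p -> R) (n : mindex p).

(* l_{r+1} + ... + l_p in 1-based notation: the lambda_r of the 1-based index
   r is lam l (r - 1), and lam l p = 0. *)
Definition lam (l : 'I_p -> nat) (r : nat) : nat :=
  (\sum_(i < p | (r <= i)%N) l i)%N.

Definition laguerreII alpha n : {poly R} :=
  \sum_(l : {dffun forall i : 'I_p, 'I_(n i).+1})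
    ((-1) ^+ mweight n
     * \prod_(q < p)
         (poch (alpha q + 1) (n q) * (poch (- (n q)%:R) (l q) / (l q)`!%:R))
     * \prod_(r < p)
         (poch (alpha r + (n r)%:R + 1) (lam (fun i => l i) r.+1)
          / poch (alpha r + 1) (lam (fun i => l i) r)))
    *: 'X^(\sum_(i < p) l i)%N.

Definition laguerreI alpha (i : 'I_p) n : {poly R} :=
  if n i == 0%N then 0 else
  ((-1) ^+ (mweight n).-1
   / ((n i).-1`!%:R * Gamma (alpha i + 1)
      * \prod_(q < p | q != i) poch (alpha q - alpha i) (n q)))
  *: \sum_(l < n i)
       (poch (- (n i)%:R + 1) l / (l`!%:R * poch (alpha i + 1) l)
        * \prod_(q < p | q != i)
            (poch (alpha i - alpha q - (n q)%:R + 1) l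
             / poch (alpha i - alpha q + 1) l))
       *: 'X^l.

Definition b0 alpha (k : 'I_p) n : R :=
  (alpha k + (n k)%:R + 1)
  * \prod_(q < p)
      ((alpha k - alpha q + (n k)%:R + 1)
       / (alpha k - alpha q + (n k)%:R + 1 - (n q)%:R))
  + \sum_(i < p)
      (alpha i + (n i)%:R)
      / (alpha i - alpha k - (n k)%:R + (n i)%:R - 1)
      * (\prod_(q < p) (alpha i - alpha q + (n i)%:R)
         / \prod_(q < p | q != i)
             (alpha i - alpha q + (n i)%:R - (n q)%:R)).

Definition bj alpha (pi : 'S_p) (j : nat) n : R :=
  \sum_(i in Sset pi j)
     (alpha i + (n i)%:R) * \prod_(q < p) (alpha i - alpha q + (n i)%:R)
     / \prod_(q in Sset pi j | q != i)
         (alpha i - alpha q + (n i)%:R - (n q)%:R).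

End MultipleLaguerre.

(* Main.v *)
Require Import Defs.
From HB Require Import structures.
From mathcomp Require Import all_boot all_order all_algebra all_fingroup.
From mathcomp Require Import ring lra zify.
From mathcomp Require Import all_classical all_reals all_analysis.

Set Implicit Arguments.
Unset Strict Implicit.
Unset Printing Implicit Defensive.

Import Order.TTheory GRing.Theory Num.Theory.

Local Open Scope ring_scope.

(** Put [beta q = alpha q + n q].  Both recurrences express one identity
    between polynomials in an auxiliary variable [t]:

      t * prod_q (t - alpha q) = (t + |n|) * prod_q (t - beta q)
          + sum_j b^j * prod_(q in S(pi, j+1)) (t - beta q).

    Divided by [prod_q (t - beta q)] it says that a rational function which
    grows like [t] is a linear polynomial plus a part with simple poles at the
    points [beta q].  These points are distinct because the differences of the
    [alpha q] are not integers.  The part with poles is a Lagrange interpolant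
    whose nodes are the [beta q]; writing it in Newton form, with the nodes
    removed in the order [pi], produces divided differences, and these are the
    [b^j] ([symbol_identity]).  The number [b^0(k)] is the same rational
    function with its simple fractions subtracted, evaluated at
    [t = beta k + 1], hence it is equal to [beta k + 1 + |n|] ([b0E]).

    Type II.  The functional sending [x^j] to [(t)_j] is the Mellin transform
    with weight [exp(-x)] divided by [Gamma(t)].  The Chu-Vandermonde sum,
    applied to the summation indices one after the other, shows that it sends
    [L_n] to the product [prod_q (-1)^(n q) (alpha q + 1 - t)_(n q)]
    ([mellin_laguerreII]).  Multiplication by [x] becomes the replacement of
    [t] by [t + 1] together with a factor [t], and raising one entry of the
    multi-index by one multiplies the transform by a linear factor.  The
    recurrence is then the identity above times the transform of
    [L_(n - (1, ..., 1))], and the transform is injective.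

    Type I.  The coefficient of [x^l] in [L^(i)_n] is, up to sign, the
    residue at [t = alpha i + l] of [1 / (Gamma(t+1) prod_q (alpha q - t)_(n q))].
    It depends on [n] through a product over [q] ([coef_laguerreI]), now with
    linear factors appearing when an entry is lowered, so that the recurrence
    is the same identity times the coefficient for [n + (1, ..., 1)].  Both
    multipliers were chosen so that nothing is divided by [t - beta q], which
    may vanish. *)

(** * Lagrange and Newton interpolation *)

Section Interpolation.
Variables (F : fieldType) (I : finType).
Implicit Types (a x w : I -> F) (S : {set I}) (t : F).

Definition divdiff x w S : F :=
  \sum_(i in S) w i / \prod_(q in S | q != i) (x i - x q).

Definition lagrange x w S t : F :=
  \sum_(i in S) w i * \prod_(q in S | q != i) ((t - x q) / (x i - x q)).

(** The difference of the two interpolants vanishes at the nodes in [S], hence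
    is a multiple of [prod (t - x q)]; the multiplier is found termwise from
    [(t - x b) / (x i - x b) - 1 = (t - x i) / (x i - x b)]. *)
Lemma lagrange_setU1 x w b S t : injective x -> b \notin S ->
  lagrange x w (b |: S) t =
    divdiff x w (b |: S) * \prod_(q in S) (t - x q) + lagrange x w S t.
Proof.
move=> x_inj bS.
have subb i : i \in S -> x i - x b != 0.
  by move=> iS; rewrite subr_eq0 (inj_eq x_inj); apply: contraNneq bS => <-.
rewrite /lagrange /divdiff !big_setU1 //= mulrDl -addrA; congr (_ + _).
  have prod_b (f : I -> F) :
      \prod_(q in b |: S | q != b) f q = \prod_(q in S) f q.
    apply: eq_bigl => q; rewrite in_setU1; case: eqP => [->|_].
      by rewrite (negPf bS) andbF.
    by rewrite andbT.
  by rewrite !prod_b prodf_div mulrA mulrAC.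
rewrite mulr_suml -big_split; apply: eq_bigr => i iS /=.
have prod_b (f : I -> F) : \prod_(q in b |: S | q != i) f q
    = f b * \prod_(q in S | q != i) f q.
  rewrite (bigD1 b) /= ?setU11 //; last by apply: contraNneq bS => ->.
  congr (_ * _); apply: eq_bigl => q; rewrite in_setU1.
  by case: (eqVneq q b) => [->|_]; rewrite ?(negPf bS) ?andbF ?andbT.
rewrite !prod_b (bigD1 i iS) /= !prodf_div.
have P0 : \prod_(q in S | q != i) (x i - x q) != 0.
  apply/prodf_neq0 => q /andP[_ qi]; rewrite subr_eq0 (inj_eq x_inj).
  by rewrite eq_sym.
by field; rewrite P0 subb.
Qed.

Lemma lagrange_setT x w t :
  lagrange x w [set: I]%SET t
  = \sum_i w i * \prod_(q | q != i) ((t - x q) / (x i - x q)).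
Proof.
apply: eq_big => [i|i _]; first by rewrite inE.
by congr (_ * _); apply: eq_bigl => q; rewrite inE.
Qed.

Lemma lagrange_node x w S i : injective x -> i \in S ->
  lagrange x w S (x i) = w i.
Proof.
move=> x_inj iS; rewrite /lagrange (bigD1 i) //= big1 => [|q /andP[_ qi]].
  rewrite mulr1 big1 ?addr0 // => q /andP[_ qi].
  by rewrite (bigD1 i) ?iS 1?eq_sym //= subrr !mul0r mulr0.
by rewrite divff // subr_eq0 (inj_eq x_inj) eq_sym.
Qed.

(** The quotient [t * prod (t - a q) / prod (t - x q)] is a linear
    polynomial plus simple fractions; here its denominators are cleared.  The
    linear part is read off from the two leading coefficients, and the rest,
    having degree below [#|I|], is interpolated at the points [x i], where
    [prod (t - x q)] vanishes. *)
Lemma mulX_prod_sub a x t : injective x ->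
  t * \prod_q (t - a q) =
    (t + \sum_q (x q - a q)) * \prod_q (t - x q)
    + lagrange x (fun i => x i * \prod_q (x i - a q)) [set: I]%SET t.
Proof.
move=> x_inj; set c := \sum_q _; set w := fun i => x i * \prod_q (x i - a q).
pose A (f : I -> F) : {poly F} := \prod_q ('X - (f q)%:P).
pose C i := w i / \prod_(q | q != i) (x i - x q).
pose E : {poly F} := 'X * A a - ('X + c%:P) * A x
  - \sum_i C i *: \prod_(q | q != i) ('X - (x q)%:P).
have AE f : A f = \prod_(y <- [seq f q | q <- index_enum I]) ('X - y%:P).
  by rewrite big_map.
have hornA f u : (A f).[u] = \prod_q (u - f q).
  by rewrite horner_prod; apply: eq_bigr => q _; rewrite !hornerE.
have sizeA f : size (A f) = #|I|.+1.
  rewrite AE size_prod_XsubC size_map.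
  by rewrite cardE enumT /index_enum -?enumT.
have lagE u : (\sum_i C i *: \prod_(q | q != i) ('X - (x q)%:P)).[u]
    = lagrange x w [set: I]%SET u.
  rewrite horner_sum lagrange_setT; apply: eq_bigr => i _.
  rewrite hornerZ horner_prod /C.
  rewrite prodf_div mulrAC mulrA; congr (_ * _ / _).
  by apply: eq_bigr => q _; rewrite !hornerE.
have lead f : (A f)`_#|I| = 1.
  have /monicP := monic_prod_XsubC (index_enum I) xpredT f.
  by rewrite lead_coefE -/(A f) sizeA.
have leadP f : (0 < #|I|)%N -> (A f)`_#|I|.-1 = - \sum_q f q.
  have -> : #|I| = size [seq f q | q <- index_enum I].
    by rewrite size_map cardE enumT.
  rewrite AE => I_gt0; rewrite coefPn_prod_XsubC ?big_map //.
  by rewrite -lt0n.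
have big_coef f j : (#|I| < j)%N -> (A f)`_j = 0.
  by move=> jI; rewrite nth_default ?sizeA.
(* Each Lagrange basis polynomial has degree #|I| - 1. *)
have lag_coef j : (#|I| <= j)%N ->
    (\sum_i C i *: \prod_(q | q != i) ('X - (x q)%:P))`_j = 0.
  move=> jI; rewrite coef_sum big1 // => i _; rewrite coefZ nth_default ?mulr0 //.
  rewrite -big_filter size_prod_XsubC (leq_trans _ jI) // size_filter.
  rewrite cardE enumT -(count_predC (pred1 i)) -add1n leq_add2r.
  by rewrite -has_count; apply/hasP; exists i; rewrite ?mem_index_enum /=.
have sizeE : (size E <= #|I|)%N.
  apply/leq_sizeP => j jI.
  rewrite !coefB mulrDl coefD !coefXM coefCM lag_coef // subr0.
  case: (posnP #|I|) => [I0|I_gt0].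
    rewrite /c big1 => [|q _]; last by have := fintype0 q I0.
    case: eqP => [_|/eqP j0]; first by rewrite mul0r addr0 subrr.
    by rewrite mul0r addr0 /A !big1 ?subrr // => q _; have := fintype0 q I0.
  have /negPf-> : j != 0%N by rewrite -lt0n (leq_trans I_gt0).
  (* The constant c is exactly what cancels the coefficient of order #|I|. *)
  move: jI; rewrite leq_eqVlt => /predU1P[<-|jI].
    by rewrite !leadP // lead mulr1 /c sumrB; ring.
  rewrite (big_coef _ _ jI) mulr0 addr0.
  have: (#|I| <= j.-1)%N by rewrite -ltnS (ltn_predK jI).
  rewrite leq_eqVlt => /predU1P[<-|jI']; first by rewrite !lead subrr.
  by rewrite !big_coef // subrr.
have E0 : E = 0.
  apply: (@roots_geq_poly_eq0 _ _ [seq x i | i <- enum I]).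
  - apply/allP => _ /mapP[i _ ->]; apply/rootP.
    rewrite !(hornerD, hornerN, hornerM, hornerX) lagE !hornA.
    rewrite [\prod_q (x i - x q)](bigD1 i) //= subrr mul0r mulr0 subr0.
    by rewrite lagrange_node // subrr.
  - by rewrite map_inj_uniq ?enum_uniq.
  - by rewrite size_map -cardE.
have /(congr1 (fun P : {poly F} => P.[t])) := E0.
rewrite !(hornerD, hornerN, hornerM, hornerX, hornerC, horner0) lagE !hornA.
by move=> /eqP; rewrite subr_eq0 subr_eq addrC => /eqP ->.
Qed.

End Interpolation.

(** * Multi-indices and the sets S(pi, j) *)

Section Indicators.
Variable p : nat.
Implicit Types (n : mindex p) (S : {set 'I_p}) (pi : 'S_p).

Definition indicator S : mindex p := [ffun i => (i \in S : nat)].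

Lemma addmE n m i : (n + m) i = (n i + m i)%N.
Proof. by rewrite ffunE. Qed.

Lemma indicatorE S i : indicator S i = (i \in S).
Proof. by rewrite ffunE. Qed.

Lemma evecE k : evec k = indicator (finset.set1 k).
Proof. by apply/ffunP => i; rewrite !ffunE inE. Qed.

Lemma in_SsetS pi j i : (i \in Sset pi j.+1) = (j <= (pi^-1)%g i)%N.
Proof. by rewrite inE. Qed.

Lemma Sset1 pi : Sset pi 1 = [set: 'I_p]%SET.
Proof. by apply/setP => i; rewrite !inE. Qed.

Lemma Sset_gt pi : Sset pi p.+1 = finset.set0.
Proof. by apply/setP => i; rewrite in_SsetS leqNgt ltn_ord inE. Qed.

Lemma SsetS pi (j : 'I_p) : Sset pi j.+1 = (pi j |: Sset pi j.+2)%SET.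
Proof.
apply/setP => i; rewrite in_setU1 !in_SsetS leq_eqVlt; congr (_ || _).
by rewrite -(inj_eq (@perm_inj _ (pi^-1)%g) i) permK eq_sym.
Qed.

Lemma Sset_notin pi (j : 'I_p) : pi j \notin Sset pi j.+2.
Proof. by rewrite in_SsetS permK ltnn. Qed.

Lemma svecE pi j : svec pi j = indicator (~: Sset pi j.+1)%SET.
Proof.
apply/ffunP => i; rewrite sum_ffunE indicatorE finset.in_setC in_SsetS -ltnNge.
rewrite big_mkcond (bigD1 ((pi^-1)%g i)) //= big1 ?addr0 => [|r rpi].
  by rewrite ffunE permKV eqxx; case: ifP.
rewrite ffunE; case: eqP => [ir|_]; last by case: ifP.
by rewrite ir permK eqxx in rpi.
Qed.

Lemma mweightD n m : mweight (n + m) = (mweight n + mweight m)%N.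
Proof. by rewrite /mweight -big_split; apply: eq_bigr => i _; rewrite addmE. Qed.

Lemma mweight_evec k : mweight (evec k : mindex p) = 1%N.
Proof.
rewrite /mweight (bigD1 k) //= big1 ?ffunE ?eqxx // => i /negPf ik.
by rewrite ffunE ik.
Qed.

Lemma msubK n m : mle m n -> msub n m + m = n.
Proof. by move=> mn; apply/ffunP => i; rewrite addmE ffunE subnK. Qed.

(** The nodes [x (pi 0), x (pi 1), ...] being removed one at a time,
    telescoping [lagrange_setU1] yields the Newton form of the interpolant. *)
Lemma newton_interpolation (F : fieldType) (x w : 'I_p -> F) pi u :
  injective x ->
  \sum_(j < p) divdiff x w (Sset pi j.+1) * \prod_(q in Sset pi j.+2) (u - x q)
    = lagrange x w [set: 'I_p]%SET u.
Proof.
move=> x_inj.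
pose L j := lagrange x w (Sset pi j.+1) u.
under eq_bigr => j _.
  have -> : divdiff x w (Sset pi j.+1) * \prod_(q in Sset pi j.+2) (u - x q)
      = L j - L j.+1.
    rewrite /L (SsetS pi j) lagrange_setU1 ?Sset_notin //.
    by rewrite addrK.
  over.
rewrite -(big_mkord xpredT (fun j => L j - L j.+1)).
under eq_bigr do rewrite -opprB.
rewrite sumrN telescope_sumr // opprB /L Sset1 Sset_gt.
by rewrite /lagrange [X in _ - X]big1 ?subr0 // => i; rewrite inE.
Qed.

End Indicators.

(** * The recurrence coefficients *)

Section Coefficients.
Variables (R : realType) (p : nat) (alpha : 'I_p -> R).
Hypothesis alpha_nint : forall i j, i != j -> alpha i - alpha j \isn't a Num.int.
Implicit Types (n : mindex p) (pi : 'S_p) (t : R).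

Definition shifted n (q : 'I_p) : R := alpha q + (n q)%:R.

(** A coincidence of two nodes would make a difference of two [alpha]'s an
    integer. *)
Lemma shifted_inj n : injective (shifted n).
Proof.
move=> i j /eqP; rewrite /shifted => /eqP E; apply/eqP/negPn/negP => ij.
have /negP := alpha_nint ij; apply.
have -> : alpha i - alpha j = (n j)%:R - (n i)%:R by move: E; lra.
by rewrite rpredB // ?natr_int.
Qed.

Lemma bjE pi j n :
  bj alpha pi j n
  = divdiff (shifted n) (fun i => shifted n i * \prod_q (shifted n i - alpha q))
      (Sset pi j).
Proof.
apply: eq_bigr => i _; rewrite /shifted; congr (_ * _ / _).
  by apply: eq_bigr => q _; ring.
by apply: eq_bigr => q _; ring.
Qed.

Lemma sum_shiftedB n : \sum_q (shifted n q - alpha q) = (mweight n)%:R.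
Proof.
by rewrite /mweight natr_sum; apply: eq_bigr => q _; rewrite /shifted; ring.
Qed.

(** The common source of both recurrences. *)
Lemma symbol_identity pi n t :
  t * \prod_q (t - alpha q) =
    (t + (mweight n)%:R) * \prod_q (t - shifted n q)
    + \sum_(j < p) bj alpha pi j.+1 n
        * \prod_(q in Sset pi j.+2) (t - shifted n q).
Proof.
rewrite (mulX_prod_sub alpha t (@shifted_inj n)) sum_shiftedB; congr (_ + _).
rewrite -(newton_interpolation _ pi) //; last exact: shifted_inj.
by apply: eq_bigr => j _; rewrite bjE.
Qed.

(** The sum in [b0] consists of minus the simple fractions of the rational
    function [t * prod (t - alpha q) / prod (t - beta q)] at [t = beta k + 1],
    and its first term is that function itself; only the linear part remains.
    In particular the dependence of [b0] on [k] is through [beta k] alone. *)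
Lemma b0E k n : b0 alpha k n = shifted n k + 1 + (mweight n)%:R.
Proof.
set T := shifted n k + 1.
have TB q : T - shifted n q != 0.
  have [->|qk] := eqVneq q k; first by rewrite /T addrAC subrr add0r oner_eq0.
  apply/negP => /eqP E; have /negP := alpha_nint qk; apply.
  have -> : alpha q - alpha k = (n k)%:R + 1 - (n q)%:R.
    by move: E; rewrite /T /shifted; lra.
  by rewrite rpredB ?rpredD ?natr_int ?rpred1.
have P0 : \prod_q (T - shifted n q) != 0 by apply/prodf_neq0 => q _.
have E := mulX_prod_sub alpha T (@shifted_inj n).
rewrite sum_shiftedB in E; set L := lagrange _ _ _ _ in E.
have -> : T + (mweight n)%:R
    = T * (\prod_q (T - alpha q) / \prod_q (T - shifted n q))
      - L / \prod_q (T - shifted n q).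
  by rewrite mulrA E; field.
rewrite -prodf_div /b0; congr (_ * _ + _).
  by apply: eq_bigr => q _; rewrite /T /shifted; congr (_ / _); ring.
rewrite /L lagrange_setT mulr_suml -sumrN; apply: eq_bigr => i _.
rewrite prodf_div (bigD1 i) //= [\prod_q (T - shifted n q)](bigD1 i) //=.
have P1 : \prod_(q | q != i) (T - shifted n q) != 0.
  by apply/prodf_neq0 => q _.
have P2 : \prod_(q | q != i) (shifted n i - shifted n q) != 0.
  apply/prodf_neq0 => q qi; rewrite subr_eq0 (inj_eq (@shifted_inj n)).
  by rewrite eq_sym.
rewrite [\prod_q (shifted n i - alpha q)](bigD1 i) //=.
have -> : \prod_(q | q != i) (alpha i - alpha q + (n i)%:R)
    = \prod_(q | q != i) (shifted n i - alpha q).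
  by apply: eq_bigr => q _; rewrite /shifted; ring.
have -> : \prod_(q | q != i) (alpha i - alpha q + (n i)%:R - (n q)%:R)
    = \prod_(q | q != i) (shifted n i - shifted n q).
  by apply: eq_bigr => q _; rewrite /shifted; ring.
have -> : alpha i - alpha k - (n k)%:R + (n i)%:R - 1 = - (T - shifted n i).
  by rewrite /T /shifted; ring.
rewrite -/(shifted n i); have := TB i; rewrite /shifted => TBi.
by field; rewrite P1 P2 -/(shifted n i) TB.
Qed.

End Coefficients.

(** * Pochhammer symbols *)

Section Pochhammer.
Variable R : realType.
Implicit Types (x b c t : R) (m n l N : nat).

Lemma poch0 x : poch x 0 = 1.
Proof. exact: big_ord0. Qed.

Lemma pochSr x n : poch x n.+1 = poch x n * (x + n%:R).
Proof. exact: big_ord_recr. Qed.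

Lemma pochSl x n : poch x n.+1 = x * poch (x + 1) n.
Proof.
rewrite /poch big_ord_recl addr0; congr (_ * _).
by apply: eq_bigr => i _; rewrite lift0 -natr1; ring.
Qed.

Lemma pochD x m n : poch x (m + n) = poch x m * poch (x + m%:R) n.
Proof.
elim: n => [|n IH]; first by rewrite addn0 poch0 mulr1.
by rewrite addnS !pochSr IH natrD; ring.
Qed.

Lemma poch_gt0 x n : 0 < x -> 0 < poch x n.
Proof. by move=> x0; apply: prodr_gt0 => i _; rewrite ltr_wpDr. Qed.

Lemma poch_neq0 x n : (forall i, (i < n)%N -> x + i%:R != 0) -> poch x n != 0.
Proof. by move=> h; apply/prodf_neq0 => i _; apply: h. Qed.

Lemma poch_oppn n l : poch (- n%:R : R) l = (-1) ^+ l * (n ^_ l)%:R.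
Proof.
elim: l => [|l IH]; first by rewrite poch0 expr0 ffactn0 mulr1.
rewrite pochSr IH exprSr ffactnSr natrM.
have [ln|nl] := leqP l n; first by rewrite natrB //; ring.
by rewrite ffact_small //; ring.
Qed.

Lemma poch_oppn_fact n l :
  poch (- n%:R : R) l / l`!%:R = (-1) ^+ l * 'C(n, l)%:R.
Proof.
by rewrite poch_oppn -bin_ffact natrM mulrA mulfK.
Qed.

Lemma poch_opp x N : poch (- x) N = (-1) ^+ N * poch (x - N%:R + 1) N.
Proof.
elim: N x => [|N IH] x; first by rewrite !poch0 mulr1.
rewrite pochSr IH [in RHS]pochSl exprSr.
have -> : x - N.+1%:R + 1 = x - N%:R by rewrite -natr1; ring.
by ring.
Qed.

(** Up to the sign of [poch_opp], both sides are [poch (x - N + 1) (N + l)]. *)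
Lemma poch_reflect x N l :
  poch (x - N%:R + 1) l * poch (- x - l%:R) N = poch (x + 1) l * poch (- x) N.
Proof.
rewrite -[- x - _]opprD !poch_opp mulrCA [RHS]mulrCA; congr (_ * _).
have -> : x + l%:R - N%:R + 1 = x - N%:R + 1 + l%:R by ring.
rewrite -pochD addnC pochD mulrC; congr (poch _ _ * _); ring.
Qed.

(** The Chu-Vandermonde evaluation of [2F1(-n, b; c; 1)], multiplied by
    [(c)_n] so that it is a polynomial identity; Pascal's rule splits the sum
    for [n+1] into the sums for [(b, c)] and [(b+1, c+1)]. *)
Lemma chu_vandermonde n b c :
  \sum_(l < n.+1) (-1) ^+ l * 'C(n, l)%:R * poch b l * poch (c + l%:R) (n - l)
    = poch (c - b) n.
Proof.
elim: n b c => [|n IH] b c.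
  by rewrite big_ord_recl big_ord0 subnn !poch0 bin0 expr0 !mulr1 addr0.
have E1 : \sum_(l < n.+2) (-1) ^+ l * 'C(n, l)%:R * poch b l
    * poch (c + l%:R) (n.+1 - l) = (c + n%:R) * poch (c - b) n.
  rewrite big_ord_recr /= bin_small // mulr0 !mul0r addr0 -IH mulr_sumr.
  apply: eq_bigr => l _; have ln : (l <= n)%N by rewrite -ltnS.
  by rewrite subSn // pochSr natrB //; ring.
have E2 : \sum_(l < n.+1) (-1) ^+ l.+1 * 'C(n, l)%:R * poch b l.+1
    * poch (c + l.+1%:R) (n.+1 - l.+1) = - b * poch (c - b) n.
  have -> : c - b = (c + 1) - (b + 1) by ring.
  rewrite -IH mulr_sumr; apply: eq_bigr => l _.
  rewrite subSS pochSl exprSr -natr1.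
  have -> : c + (l%:R + 1) = c + 1 + l%:R by ring.
  ring.
have -> : poch (c - b) n.+1 = (c + n%:R) * poch (c - b) n + - b * poch (c - b) n.
  by rewrite pochSr; ring.
rewrite -E1 -E2 big_ord_recl [in RHS]big_ord_recl /= -addrA -big_split /=.
rewrite !bin0; congr (_ + _); apply: eq_bigr => l _.
by rewrite /bump /= !add1n binS natrD; ring.
Qed.

(** Summation over one of the indices of the multiple sum for [L_n]; [m] is
    the sum of the indices that follow it. *)
Lemma laguerreII_factor_sum (A t : R) n m : 0 < A ->
  \sum_(l < n.+1) poch A n * (poch (- n%:R) l / l`!%:R)
     * (poch (A + n%:R) m / poch A (l + m)) * poch t (l + m)
  = poch (A - t) n * poch t m.
Proof.
move=> A0.
have -> : A - t = (A + m%:R) - (t + m%:R) by ring.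
rewrite -chu_vandermonde mulr_suml; apply: eq_bigr => l _.
have ln : (l <= n)%N by rewrite -ltnS.
have nz (k : nat) : poch A k != 0 by rewrite gt_eqF // poch_gt0.
have nz' (k : nat) : poch (A + m%:R) k != 0.
  by rewrite gt_eqF // poch_gt0 // ltr_wpDr.
have E : poch A n * poch (A + n%:R) m = poch A m
    * (poch (A + m%:R) l * poch (A + m%:R + l%:R) (n - l)).
  by rewrite -!pochD addnC subnKC.
rewrite poch_oppn_fact [(l + m)%N]addnC !pochD.
transitivity (poch A n * poch (A + n%:R) m * ((-1) ^+ l * 'C(n, l)%:R)
   / (poch A m * poch (A + m%:R) l) * (poch t m * poch (t + m%:R) l)).
  ring.
by rewrite E; field; rewrite nz nz'.
Qed.

End Pochhammer.

(** * Sums over families of indices with individual bounds *)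

Section DependentSums.

Lemma big_dffun_ord0 (T : nmodType) (n : 'I_0 -> nat) (f : ('I_0 -> nat) -> T) :
  \sum_(l : {dffun forall i, 'I_(n i).+1}) f (fun i => l i) = f (fun=> 0%N).
Proof.
pose l0 : {dffun forall i, 'I_(n i).+1} := [ffun i => ord0].
rewrite (big_pred1 l0) => [|l].
  by congr f; apply: funext; case.
by apply/esym/eqP/ffunP; case.
Qed.

Definition cons_index p (a : nat) (l : 'I_p -> nat) (i : 'I_p.+1) : nat :=
  oapp l a (unlift ord0 i).

Lemma big_dffun_ordS (T : nmodType) p (n : 'I_p.+1 -> nat)
    (f : ('I_p.+1 -> nat) -> T) :
  \sum_(l : {dffun forall i, 'I_(n i).+1}) f (fun i => l i)
  = \sum_(l : {dffun forall i : 'I_p, 'I_(n (lift ord0 i)).+1})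
      \sum_(a < (n ord0).+1) f (cons_index a (fun i => l i)).
Proof.
(* inord spares the casts between the ordinals bounded by n ord0, by
   n (lift ord0 j) and by n i; its argument is always within bounds. *)
pose h (u : {dffun forall i : 'I_p, 'I_(n (lift ord0 i)).+1} * 'I_(n ord0).+1)
    : {dffun forall i, 'I_(n i).+1} :=
  [ffun i => inord (cons_index u.2 (fun j => u.1 j) i)].
pose g (l : {dffun forall i, 'I_(n i).+1}) :
    {dffun forall i : 'I_p, 'I_(n (lift ord0 i)).+1} * 'I_(n ord0).+1 :=
  ([ffun j => l (lift ord0 j)], l ord0).
have hE u i : h u i = cons_index u.2 (fun j => u.1 j) i :> nat.
  rewrite ffunE inordK // /cons_index.
  by case: unliftP => [j|] ->; rewrite /= ltn_ord.
have hK : cancel h g.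
  case=> l a; congr (_, _).
    apply/ffunP => j; rewrite ffunE; apply: val_inj.
    by rewrite /= hE /cons_index liftK.
  by apply: val_inj; rewrite /= hE /cons_index unlift_none.
have gK : cancel g h.
  move=> l; apply/ffunP => i; apply: val_inj; rewrite /= hE /cons_index.
  by case: unliftP => [j|] ->; rewrite /= ?ffunE.
rewrite pair_big (reindex h) /=; last by exists g => ? _; [exact: hK|exact: gK].
by apply: eq_bigr => u _; congr f; apply: funext => i; rewrite hE.
Qed.

End DependentSums.

(** * A Mellin transform of polynomials *)

Section Mellin.
Variable R : realType.
Implicit Types (f g : {poly R}) (t : R).

(** Since the integral of [x^(t-1) x^j exp(-x)] over the half-line is
    [Gamma(t + j) = Gamma(t) (t)_j], this is the Mellin transform of
    [f(x) exp(-x)] divided by [Gamma(t)]. *)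
Definition mellin t f : R := \sum_(j < size f) f`_j * poch t j.

Lemma mellin_wide N t f : (size f <= N)%N ->
  mellin t f = \sum_(j < N) f`_j * poch t j.
Proof.
move=> fN; rewrite /mellin (big_ord_widen N (fun j => f`_j * poch t j) fN).
rewrite big_mkcond; apply: eq_bigr => j _; case: ltnP => // jf.
by rewrite nth_default ?mul0r.
Qed.

Lemma mellin_is_linear t : linear_for *%R (mellin t).
Proof.
move=> a f g; pose N := maxn (size f) (size g).
have fN : (size f <= N)%N by rewrite leq_maxl.
have gN : (size g <= N)%N by rewrite leq_maxr.
have fgN : (size (a *: f + g)%R <= N)%N.
  by rewrite (leq_trans (size_polyD _ _)) // geq_max gN
    (leq_trans (size_scale_leq _ _)).
rewrite !(mellin_wide (N := N)) // mulr_sumr -big_split.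
by apply: eq_bigr => j _; rewrite coefD coefZ /=; ring.
Qed.

HB.instance Definition _ t :=
  GRing.isLinear.Build R {poly R} R _ (mellin t) (mellin_is_linear t).

Lemma mellinXn t j : mellin t 'X^j = poch t j.
Proof.
rewrite (mellin_wide (N := j.+1)) ?size_polyXn // big_ord_recr /= coefXn eqxx.
by rewrite mul1r big1 ?add0r // => i _; rewrite coefXn ltn_eqF ?mul0r.
Qed.

Lemma mellin_mulX t f : mellin t ('X * f) = t * mellin (t + 1) f.
Proof.
rewrite (mellin_wide (N := (size f).+1)); last first.
  by rewrite mulrC (leq_trans (size_polyMleq _ _)) // size_polyX addn2.
rewrite big_ord_recl coefXM mul0r add0r mulr_sumr; apply: eq_bigr => j _.
by rewrite coefXM lift0 /= pochSl; ring.
Qed.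

(** At [t = -m] only the coefficients of order at most [m] contribute, so
    that the values at the nonpositive integers determine the coefficients
    recursively. *)
Lemma mellin_inj f g : (forall t, mellin t f = mellin t g) -> f = g.
Proof.
move=> fg; apply/eqP; rewrite -subr_eq0; apply/eqP; set d := f - g.
have d0 t : mellin t d = 0 by rewrite linearB /= fg subrr.
apply/polyP => m; rewrite coef0; have [k] := ubnP m.
elim: k m => // k IH m mk.
have := d0 (- m%:R).
rewrite (mellin_wide (N := maxn m.+1 (size d))) ?leq_maxr //.
have mN : (m < maxn m.+1 (size d))%N by rewrite leq_max ltnSn.
rewrite (bigD1 (Ordinal mN)) //= big1 ?addr0 => [/eqP|j jm].
  rewrite mulf_eq0 => /orP[/eqP //|]; rewrite poch_oppn ffactnn mulf_eq0.
  by rewrite signr_eq0 pnatr_eq0 -[_ == 0%N]negbK -lt0n fact_gt0.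
have {jm} jm : (j : nat) != m by [].
have [jlt|jgt] := ltnP j m.
  by rewrite IH ?mul0r // (leq_trans jlt) // -ltnS.
by rewrite poch_oppn ffact_small ?mulr0 // ltn_neqAle eq_sym jm.
Qed.

End Mellin.

(** * The transform of the type II polynomials *)

Section TypeII.
Variable R : realType.

(** The coupling of the indices through the tail sums [lam l r] is triangular:
    [l 0] occurs in [lam l 0] only.  It can therefore be summed first, with
    the other indices fixed, and what remains is the same sum for the last
    [p] parameters. *)
Lemma laguerreII_sum p (alpha : 'I_p -> R) (n : 'I_p -> nat) t :
  (forall i, -1 < alpha i) ->
  \sum_(l : {dffun forall i, 'I_(n i).+1})
    \prod_(q < p)
      (poch (alpha q + 1) (n q) * (poch (- (n q)%:R) (l q) / (l q)`!%:R))
    * \prod_(r < p)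
        (poch (alpha r + (n r)%:R + 1) (lam (fun i => l i) r.+1)
         / poch (alpha r + 1) (lam (fun i => l i) r))
    * poch t (\sum_(i < p) l i)%N
  = \prod_(q < p) poch (alpha q + 1 - t) (n q).
Proof.
pose weight p (alpha : 'I_p -> R) (n l : 'I_p -> nat) : R :=
  \prod_(q < p)
      (poch (alpha q + 1) (n q) * (poch (- (n q)%:R) (l q) / (l q)`!%:R))
    * \prod_(r < p)
        (poch (alpha r + (n r)%:R + 1) (lam l r.+1) / poch (alpha r + 1) (lam l r))
    * poch t (\sum_(i < p) l i)%N.
elim: p alpha n => [|p IH] alpha n alpha_gt.
  by apply: etrans (big_dffun_ord0 n (weight _ alpha n)) _;
    rewrite /weight !big_ord0 poch0 !mulr1.
apply: etrans (big_dffun_ordS n (weight _ alpha n)) _; rewrite {}/weight.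
rewrite big_ord_recl -(IH (fun i => alpha (lift ord0 i))
  (fun i => n (lift ord0 i))) //.
rewrite mulr_sumr; apply: eq_bigr => l _.
have c0 a : cons_index a (fun i => l i) ord0 = a by rewrite /cons_index unlift_none.
have cS a i : cons_index a (fun i => l i) (lift ord0 i) = l i.
  by rewrite /cons_index liftK.
set m := (\sum_(i < p) l i)%N.
have lam0 : lam (fun i => l i) 0 = m by apply: eq_bigl.
have lamS a r : lam (cons_index a (fun i => l i)) r.+1 = lam (fun i => l i) r.
  rewrite /lam big_mkcond big_ord_recl /= add0n [RHS]big_mkcond.
  by apply: eq_bigr => i _; rewrite cS.
have lamc0 a : lam (cons_index a (fun i => l i)) 0 = (a + m)%N.
  by rewrite /lam big_ord_recl c0; under eq_bigr do rewrite cS.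
under eq_bigr => a _.
  rewrite !big_ord_recl /= c0 lamc0 lamS.
  under eq_bigr do rewrite cS.
  under [X in _ * (_ * X) * _]eq_bigr do rewrite !lamS.
  under [X in poch t (_ + X)]eq_bigr do rewrite cS.
  over.
rewrite /= -/m lam0; set P := \prod_(i < p) (_ * (_ / _)).
set Q := \prod_(i < p) (poch _ _ / _).
have A0 : 0 < alpha ord0 + 1 by rewrite -ltrBlDr sub0r.
transitivity (P * Q * (poch (alpha ord0 + 1 - t) (n ord0) * poch t m)); last first.
  by rewrite /P /Q; ring.
rewrite -laguerreII_factor_sum // mulr_sumr; apply: eq_bigr => a _.
by rewrite [alpha ord0 + (n ord0)%:R + 1]addrAC; ring.
Qed.

Definition symbolII p (alpha : 'I_p -> R) (n : mindex p) t : R :=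
  \prod_q ((-1) ^+ n q * poch (alpha q + 1 - t) (n q)).

Lemma mellin_laguerreII p (alpha : 'I_p -> R) (n : mindex p) t :
  (forall i, -1 < alpha i) -> mellin t (laguerreII alpha n) = symbolII alpha n t.
Proof.
move=> alpha_gt; rewrite /symbolII big_split -laguerreII_sum //=.
rewrite /laguerreII linear_sum mulr_sumr; apply: eq_bigr => l _.
rewrite linearZ /= mellinXn !mulrA; congr (_ * _ * _ * _).
by rewrite /mweight expr_sum.
Qed.

End TypeII.

(** * The type II recurrence *)

Section RecurrenceII.
Variables (R : realType) (p : nat) (alpha : 'I_p -> R).
Implicit Types (n : mindex p) (S : {set 'I_p}) (pi : 'S_p) (t : R).

Lemma symbolII_indicator n S t :
  symbolII alpha (n + indicator S) t
  = \prod_(q in S) (t - shifted alpha n q - 1) * symbolII alpha n t.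
Proof.
rewrite /symbolII [\prod_(q in S) _]big_mkcond -big_split /=.
apply: eq_bigr => q _; rewrite addmE indicatorE.
case: ifP => qS; last by rewrite addn0 mul1r.
by rewrite addn1 pochSr exprSr /shifted; ring.
Qed.

(** Combined with [mellin_mulX], this turns multiplication by [x] of
    [L_(n + (1, ..., 1))] into the left-hand side of [symbol_identity]. *)
Lemma symbolII_succ n t :
  symbolII alpha (n + indicator [set: 'I_p]%SET) (t + 1)
  = \prod_q (t - alpha q) * symbolII alpha n t.
Proof.
rewrite /symbolII -big_split /=; apply: eq_bigr => q _.
rewrite addmE indicatorE inE addn1 pochSl exprSr.
have -> : alpha q + 1 - (t + 1) = alpha q - t by ring.
by rewrite [alpha q - t + 1]addrAC; ring.
Qed.

Hypothesis alpha_gt : forall i, -1 < alpha i.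
Hypothesis alpha_nint : forall i j, i != j -> alpha i - alpha j \isn't a Num.int.

Lemma laguerreII_recurrence k pi n :
  (forall i, (0 < n i)%N) ->
  'X * laguerreII alpha n =
    laguerreII alpha (n + evec k) + b0 alpha k n *: laguerreII alpha n
    + \sum_(j < p)
        bj alpha pi j.+1 n *: laguerreII alpha (msub n (svec pi j.+1)).
Proof.
(* Every index in the relation is m plus an indicator, apart from n + evec k,
   which raises n once more. *)
move=> n_gt0; set m := [ffun i => (n i).-1] : mindex p.
have nE : n = m + indicator [set: 'I_p]%SET.
  by apply/ffunP => i; rewrite addmE indicatorE inE ffunE addn1 prednK.
have shiftE t q : t - shifted alpha m q - 1 = t - shifted alpha n q.
  by rewrite /shifted ffunE -[n q in RHS]prednK // -natr1; ring.
have msubE j : msub n (svec pi j.+1) = m + indicator (Sset pi j.+2).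
  apply/ffunP => i; rewrite svecE addmE !ffunE finset.in_setC.
  by case: (i \in _); rewrite /= ?subn0 ?subn1 ?addn1 ?addn0 ?prednK.
have : forall n' t, mellin t (laguerreII alpha n') = symbolII alpha n' t.
  by move=> n' t; rewrite mellin_laguerreII.
move: (laguerreII alpha) => L mellinL.
apply: mellin_inj => t; rewrite mellin_mulX !linearD linear_sum /=.
under [in RHS]eq_bigr => j _.
  rewrite linearZ /= mellinL msubE symbolII_indicator mulrA.
  under eq_bigr do rewrite shiftE.
  over.
have symE : symbolII alpha n t
    = \prod_q (t - shifted alpha n q) * symbolII alpha m t.
  rewrite {1}nE symbolII_indicator; congr (_ * _).
  by apply: eq_big => [q|q _]; rewrite ?inE ?shiftE.
rewrite linearZ /= !mellinL evecE symbolII_indicator.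
rewrite {1}nE symbolII_succ symE finset.big_set1 b0E // -mulr_suml.
rewrite mulrA (symbol_identity alpha_nint pi n).
by ring.
Qed.

End RecurrenceII.

(** * The type I recurrence *)

Section RecurrenceI.
Variables (R : realType) (p : nat) (alpha : 'I_p -> R).
Implicit Types (n : mindex p) (S : {set 'I_p}) (pi : 'S_p) (t : R).
Hypothesis alpha_gt : forall i, -1 < alpha i.
Hypothesis alpha_nint : forall i j, i != j -> alpha i - alpha j \isn't a Num.int.

(** The coefficient of [x^l] in [L^(i)_n] is [constI i l] times the product
    over [q] of these factors at [N = n q].  For [q <> i] the factor is, up to
    sign, the reciprocal of [(alpha q - t)_N] at [t = alpha i + l]; for
    [q = i] that reciprocal has a pole, and the factor is its residue without
    the part independent of [N].  The numerator [l < N] accounts for the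
    absence of a pole when [N <= l]. *)
Definition factorI (i : 'I_p) (l : nat) (q : 'I_p) (N : nat) : R :=
  (-1) ^+ N * (if q == i then (l < N)%:R / (N.-1 - l)`!%:R
               else (poch (alpha q - alpha i - l%:R) N)^-1).

Definition constI (i : 'I_p) (l : nat) : R :=
  (-1) ^+ l.+1 * (Gamma (alpha i + 1))^-1 / (l`!%:R * poch (alpha i + 1) l).

Lemma alphaB_intr_neq0 q i (z : R) : q != i -> z \is a Num.int ->
  alpha q - alpha i + z != 0.
Proof.
move=> qi zint; apply/negP; rewrite addr_eq0 => /eqP E.
by have /negP := alpha_nint qi; rewrite E rpredN.
Qed.

Lemma poch_alphaB_neq0 q i (z : R) N : q != i -> z \is a Num.int ->
  poch (alpha q - alpha i + z) N != 0.
Proof.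
move=> qi zint; apply: poch_neq0 => j _; rewrite -addrA.
by rewrite alphaB_intr_neq0 // rpredD ?natr_int.
Qed.

(** The reflection [poch_reflect] merges the two ratios of Pochhammer symbols
    attached to [q <> i] and the normalising factor of [L^(i)_n] into one
    reciprocal. *)
Lemma coef_laguerreI i n l :
  (laguerreI alpha i n)`_l = constI i l * \prod_q factorI i l q (n q).
Proof.
rewrite (bigD1 i) //= /factorI eqxx /laguerreI.
case: eqP => [->|/eqP]; first by rewrite coef0 !mul0r !mulr0 mul0r mulr0.
rewrite -lt0n => n_gt0.
have -> : \sum_(l < n i)
       (poch (- (n i)%:R + 1) l / (l`!%:R * poch (alpha i + 1) l)
        * \prod_(q < p | q != i)
            (poch (alpha i - alpha q - (n q)%:R + 1) l
             / poch (alpha i - alpha q + 1) l)) *: 'X^l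
   = \poly_(l < n i)
       (poch (- (n i)%:R + 1) l / (l`!%:R * poch (alpha i + 1) l)
        * \prod_(q < p | q != i)
            (poch (alpha i - alpha q - (n q)%:R + 1) l
             / poch (alpha i - alpha q + 1) l)) by rewrite poly_def.
rewrite coefZ coef_poly; case: ltnP => [ln|_];
  last by rewrite !mul0r !mulr0 mul0r mulr0.
have fact_neq0 (m : nat) : m`!%:R != 0 :> R by rewrite pnatr_eq0 -lt0n fact_gt0.
have P0 : poch (alpha i + 1) l != 0.
  by rewrite gt_eqF // poch_gt0 // -ltrBlDr sub0r.
have Q0 : \prod_(q < p | q != i) poch (alpha q - alpha i) (n q) != 0.
  apply/prodf_neq0 => q qi; rewrite -[alpha q - alpha i]addr0.
  by rewrite poch_alphaB_neq0 ?rpred0.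
have signE : (-1) ^+ (mweight n).-1
    = - ((-1) ^+ n i * \prod_(q < p | q != i) (-1) ^+ n q) :> R.
  have <- : (-1) ^+ mweight n
      = (-1) ^+ n i * \prod_(q < p | q != i) (-1) ^+ n q :> R.
    by rewrite /mweight expr_sum (bigD1 i).
  have w_gt0 : (0 < mweight n)%N by rewrite /mweight (bigD1 i) //= addn_gt0 n_gt0.
  by rewrite -[in RHS](prednK w_gt0) exprS mulN1r opprK.
have factE : poch (- (n i)%:R + 1 : R) l
    = (-1) ^+ l * ((n i).-1)`!%:R / ((n i).-1 - l)`!%:R.
  have -> : - (n i)%:R + 1 = - (n i).-1%:R :> R.
    by rewrite -[in LHS](prednK n_gt0) -natr1; ring.
  have lni : (l <= (n i).-1)%N by rewrite -ltnS prednK.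
  by rewrite poch_oppn -(ffact_fact lni) natrM; field; rewrite fact_neq0.
have ratioE : \prod_(q < p | q != i) (poch (alpha i - alpha q - (n q)%:R + 1) l
      / poch (alpha i - alpha q + 1) l)
    = \prod_(q < p | q != i) poch (alpha q - alpha i) (n q)
      * \prod_(q < p | q != i) (poch (alpha q - alpha i - l%:R) (n q))^-1.
  rewrite -big_split; apply: eq_bigr => q qi /=.
  have := poch_reflect (alpha i - alpha q) (n q) l; rewrite opprB => E.
  have N1 : poch (alpha q - alpha i - l%:R) (n q) != 0.
    by rewrite poch_alphaB_neq0 // rpredN natr_int.
  have N2 : poch (alpha i - alpha q + 1) l != 0.
    by rewrite poch_alphaB_neq0 1?eq_sym ?rpred1.
  by apply/eqP; rewrite eqr_div // E mulrC.
under [in RHS]eq_bigr => q /negPf qi do rewrite qi.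
rewrite signE factE ratioE big_split /= /constI exprS !invfM.
move: Q0; set Q := \prod_(q < p | q != i) poch _ _ => Q0.
move: (Gamma _)^-1 => g.
by field; rewrite P0 Q0 !fact_neq0.
Qed.

(** For [q = i] the linear factor is [l - N], so that it vanishes exactly when
    the pole at [alpha i + l] is absent for [N] but present for [N + 1]. *)
Lemma factorI_succ i l q N :
  factorI i l q N = (alpha i + l%:R - alpha q - N%:R) * factorI i l q N.+1.
Proof.
rewrite /factorI; case: eqVneq => [->|qi].
  have [lN|] := ltnP l N; last rewrite leq_eqVlt => /predU1P[<-|Nl].
  - rewrite ltnS (ltnW lN) /=; set d := (N.-1 - l)%N.
    have -> : (N - l)%N = d.+1 by rewrite /d; lia.
    have -> : alpha i + l%:R - alpha i - N%:R = - d.+1%:R.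
      have -> : N = (l + d.+1)%N by rewrite /d; lia.
      by rewrite natrD; ring.
    rewrite factS natrM exprS; field.
    by rewrite nat1r !pnatr_eq0 -lt0n fact_gt0.
  - by rewrite ltnS leqnn /= mul0r mulr0; ring.
  - by rewrite ltnS leqNgt Nl /=; ring.
rewrite pochSr exprS.
have N1 : poch (alpha q - alpha i - l%:R) N != 0.
  by rewrite poch_alphaB_neq0 // rpredN natr_int.
have N2 : alpha q - alpha i - l%:R + N%:R != 0.
  by rewrite -addrA alphaB_intr_neq0 // rpredD ?rpredN ?natr_int.
by field; rewrite N1 N2.
Qed.

(** Passing from the coefficient of order [l] to that of order [l + 1] moves
    the poles by one, which is the same as raising every entry of the
    multi-index. *)
Lemma factorI_shift i l q N :
  factorI i l q N
  = (if q == i then -1 else alpha i + l.+1%:R - alpha q)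
    * factorI i l.+1 q N.+1.
Proof.
rewrite /factorI; case: eqVneq => [_|qi].
  have -> : (N.+1.-1 - l.+1)%N = (N.-1 - l)%N by lia.
  by rewrite ltnS exprS; ring.
have E : alpha q - alpha i - l.+1%:R + 1 = alpha q - alpha i - l%:R.
  by rewrite -natr1; ring.
rewrite pochSl exprS E.
have N1 : poch (alpha q - alpha i - l%:R) N != 0.
  by rewrite poch_alphaB_neq0 // rpredN natr_int.
have N2 : alpha q - alpha i - l.+1%:R != 0.
  by rewrite alphaB_intr_neq0 // rpredN natr_int.
by move: (l.+1%:R) N2 {E} => y N2; field; rewrite N1 N2.
Qed.

Lemma constI_shift i l :
  constI i l = - (l.+1%:R * (alpha i + l.+1%:R)) * constI i l.+1.
Proof.
have A0 : 0 < alpha i + 1 by rewrite -ltrBlDr sub0r.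
have E : alpha i + 1 + l%:R = alpha i + l.+1%:R by rewrite -natr1; ring.
have N1 : poch (alpha i + 1) l != 0 by rewrite gt_eqF // poch_gt0.
have N2 : alpha i + l.+1%:R != 0 by rewrite -E gt_eqF // ltr_wpDr.
rewrite /constI pochSr E factS natrM [(-1) ^+ l.+2]exprS.
have : l.+1%:R != 0 :> R by rewrite pnatr_eq0.
move: (Gamma _)^-1 (l.+1%:R) N2 {E} => g y N2 N3; field.
by rewrite N1 N2 N3 pnatr_eq0 -lt0n fact_gt0.
Qed.

Lemma coef_laguerreI_indicator i n l S :
  (laguerreI alpha i n)`_l
  = \prod_(q in S) (alpha i + l%:R - shifted alpha n q)
    * (laguerreI alpha i (n + indicator S))`_l.
Proof.
rewrite !coef_laguerreI mulrCA; congr (_ * _).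
rewrite [\prod_(q in S) _]big_mkcond -big_split /=.
apply: eq_bigr => q _; rewrite addmE indicatorE.
case: ifP => qS; last by rewrite addn0 mul1r.
by rewrite addn1 factorI_succ /shifted opprD addrA.
Qed.

(** At [l = 0] the right-hand side vanishes through the factor [t - alpha i]. *)
Lemma coef_mulX_laguerreI i n l (t := alpha i + l%:R) :
  ('X * laguerreI alpha i n)`_l
  = t * \prod_q (t - alpha q)
    * (laguerreI alpha i (n + indicator [set: 'I_p]%SET))`_l.
Proof.
rewrite coefXM /t; case: l {t} => [|l] /=.
  by rewrite (bigD1 i) //= addr0 subrr mul0r mulr0 mul0r.
rewrite !coef_laguerreI constI_shift.
under eq_bigr do rewrite factorI_shift.
rewrite big_split /=.
have -> : \prod_q factorI i l.+1 q ((n + indicator [set: 'I_p]%SET)%R q)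
    = \prod_q factorI i l.+1 q (n q).+1.
  by apply: eq_bigr => q _; rewrite addmE indicatorE inE addn1.
rewrite (bigD1 i) //= [\prod_q (_ - alpha q)](bigD1 i) //= eqxx.
under eq_bigr => q /negPf qi do rewrite qi.
ring.
Qed.

Lemma laguerreI_recurrence k pi i n :
  (0 < n k)%N ->
  'X * laguerreI alpha i n =
       laguerreI alpha i (msub n (evec k))
       + b0 alpha k (msub n (evec k)) *: laguerreI alpha i n
       + \sum_(j < p)
           bj alpha pi j.+1 (n + svec pi j)
           *: laguerreI alpha i (n + svec pi j.+1).
Proof.
move=> nk_gt0; set n' := msub n (evec k).
have nE : n = n' + evec k.
  rewrite /n' msubK // => q; rewrite ffunE; case: eqP => [->|] //.
have nk : n k = (n' k).+1.
  by rewrite {1}nE addmE evecE indicatorE inE eqxx addn1.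
have nw : mweight n = (mweight n').+1.
  by rewrite {1}nE mweightD mweight_evec addn1.
have shift_k : shifted alpha n' k = shifted alpha n k - 1.
  by rewrite /shifted nk -natr1; ring.
have b0n : b0 alpha k n' = shifted alpha n k + (mweight n)%:R - 1.
  by rewrite b0E // shift_k nw -natr1; ring.
have bjn (j : 'I_p) : bj alpha pi j.+1 (n + svec pi j) = bj alpha pi j.+1 n.
  have nj q : q \in Sset pi j.+1 -> (n + svec pi j) q = n q.
    by move=> qS; rewrite addmE svecE indicatorE finset.in_setC qS addn0.
  apply: eq_bigr => q qS; rewrite nj //; congr (_ / _).
  by apply: eq_bigr => r /andP[rS _]; rewrite nj.
apply/polyP => l; rewrite coef_mulX_laguerreI !coefD coef_sum coefZ.
set t := alpha i + l%:R; set c := (laguerreI alpha i (n + _))`_l.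
have cn : (laguerreI alpha i n)`_l = \prod_q (t - shifted alpha n q) * c.
  rewrite (coef_laguerreI_indicator _ _ _ [set: 'I_p]%SET); congr (_ * _).
  by apply: eq_bigl => q; rewrite inE.
have cnk : (laguerreI alpha i n')`_l
    = (t - shifted alpha n k + 1) * (laguerreI alpha i n)`_l.
  rewrite (coef_laguerreI_indicator _ _ _ (finset.set1 k)) finset.big_set1.
  by rewrite -evecE -nE shift_k opprB addrA addrAC.
have cnj (j : 'I_p) : (laguerreI alpha i (n + svec pi j.+1))`_l
    = \prod_(q in Sset pi j.+2) (t - shifted alpha n q) * c.
  rewrite (coef_laguerreI_indicator _ _ _ (Sset pi j.+2)); congr (_ * _).
    apply: eq_bigr => q qS.
    by rewrite /shifted addmE svecE indicatorE finset.in_setC qS addn0.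
  rewrite /c -addrA; congr (laguerreI _ _ (n + _))`_l.
  apply/ffunP => q; rewrite svecE addmE !indicatorE finset.in_setC finset.in_setT.
  by case: (q \in _).
under [\sum_(j < p) _]eq_bigr do rewrite coefZ bjn cnj mulrA.
rewrite -mulr_suml cnk cn b0n (symbol_identity alpha_nint pi n).
ring.
Qed.

End RecurrenceI.

(** * Nearest-neighbor recurrences *)

Theorem theorem3p1 (R : realType) (p : nat) (alpha : 'I_p -> R)
    (alpha_gt : forall i, -1 < alpha i)
    (alpha_nint : forall i j, i != j -> alpha i - alpha j \isn't a Num.int)
    (k : 'I_p) (pi : 'S_p) :
  (forall n : mindex p,
     (forall j, (1 <= j <= p)%N -> mle (svec pi j) n) ->
     'X * laguerreII alpha n =
       laguerreII alpha (n + evec k) + b0 alpha k n *: laguerreII alpha n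
       + \sum_(1 <= j < p.+1)
           bj alpha pi j n *: laguerreII alpha (msub n (svec pi j)))
  /\
  (forall (n : mindex p) (i : 'I_p),
     mle (evec k) n ->
     'X * laguerreI alpha i n =
       laguerreI alpha i (msub n (evec k))
       + b0 alpha k (msub n (evec k)) *: laguerreI alpha i n
       + \sum_(1 <= j < p.+1)
           bj alpha pi j (n + svec pi j.-1)
           *: laguerreI alpha i (n + svec pi j)).
Proof.
split=> [n svec_le | n i evec_le]; rewrite big_add1 big_mkord.
  (* The index n - s_p lowers every entry by one. *)
  apply: laguerreII_recurrence => // i.
  have p_gt0 : (0 < p)%N by exact: leq_ltn_trans (ltn_ord k).
  have := svec_le p; rewrite p_gt0 leqnn => /(_ isT i).
  by rewrite svecE indicatorE Sset_gt finset.in_setC inE.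
apply: laguerreI_recurrence => //.
by have := evec_le k; rewrite ffunE eqxx.
Qed.
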